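(* Let $\mathfrak g=\mathfrak h\oplus\mathfrak k$ be a semidirect product Lie algebra, with $\mathfrak h$ a subalgebra, $\mathfrak k$ an ideal and associated representation $\pi:\mathfrak h\to\operatorname{End}(\mathfrak k)$. Let $j:\mathfrak h\to\mathfrak k$ be a linear isomorphism and let $J,E:\mathfrak g\to\mathfrak g$ be the almost complex and almost paracomplex structures $$J(x,v)=(-j^{-1}v,\,jx),\qquad E(x,v)=(j^{-1}v,\,jx)\qquad (x\in\mathfrak h,\ v\in\mathfrak k).$$ The following statements are equivalent: (i) $J$ is integrable; (ii) $E$ is integrable; (iii) $\mathfrak k$ is abelian and $j:\mathfrak h\to\mathfrak k$ is a $1$-cocycle of $(\mathfrak h,\pi)$. Consequently, when $\mathfrak k$ is abelian, the pair $(J,E)$ is a complex product structure on $\mathfrak g$ whenever the linear isomorphism $j$ is a $1$-cocycle of $(\mathfrak h,\pi)$.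
   Context: All Lie algebras are real and finite-dimensional. A semidirect product Lie algebra $\mathfrak g=\mathfrak h\oplus\mathfrak k$ is a vector space direct sum of a Lie subalgebra $\mathfrak h$ and an ideal $\mathfrak k$; its bracket is $[x,y]=[x,y]_{\mathfrak h}$, $[x,v]=\pi(x)v$, $[u,v]=[u,v]_{\mathfrak k}$ for $x,y\in\mathfrak h$, $u,v\in\mathfrak k$, where $\pi:\mathfrak h\to\operatorname{End}(\mathfrak k)$ is a representation acting by derivations of $\mathfrak k$. An almost complex structure on $\mathfrak g$ is a linear map $J$ with $J^2=-\mathrm{Id}$; it is integrable if $N_J(Y,Z)=[JY,JZ]-[Y,Z]-J[JY,Z]-J[Y,JZ]=0$ for all $Y,Z\in\mathfrak g$. An almost paracomplex structure is a linear map $E$ with $E^2=\mathrm{Id}$ whose $(+1)$- and $(-1)$-eigenspaces have the same dimension; it is integrable if $N_E(Y,Z)=[EY,EZ]+[Y,Z]-E[EY,Z]-E[Y,EZ]=0$ for all $Y,Z\in\mathfrak g$. A linear map $\theta:\mathfrak h\to\mathfrak k$ is a $1$-cocycle of $(\mathfrak h,\pi)$ if $\pi(x)\theta(y)-\pi(y)\theta(x)-\theta([x,y]_{\mathfrak h})=0$ for all $x,y\in\mathfrak h$. A complex product structure is a pair consisting of an integrable almost complex structure $J$ and an integrable almost paracomplex structure $E$ with $JE=-EJ$. *)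

(* Defs.v *)
From HB Require Import structures.
From mathcomp Require Import all_boot all_algebra.
From mathcomp Require Import reals.

Set Implicit Arguments.
Unset Strict Implicit.
Unset Printing Implicit Defensive.

Import GRing.Theory.
Local Open Scope ring_scope.

HB.mixin Record isLieAlgebra (K : fieldType) g of Vector K g := {
  bracket : g -> g -> g;
  bracket_linearl : forall y : g, linear (bracket ^~ y);
  bracket_linearr : forall x : g, linear (bracket x);
  bracketxx : forall x : g, bracket x x = 0;
  bracket_jacobi : forall x y z : g,
    bracket x (bracket y z) + bracket y (bracket z x)
      + bracket z (bracket x y) = 0
}.

#[short(type="lieAlgType")]
HB.structure Definition LieAlgebra (K : fieldType) :=
  { g of isLieAlgebra K g & Vector K g }.

Notation "[ 'lie' x , y ]" := (bracket x y)
  (at level 0, x, y at level 99, format "[ 'lie'  x ,  y ]") : ring_scope.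

Definition lie_abelian (K : fieldType) (g : lieAlgType K) : Prop :=
  forall x y : g, [lie x, y] = 0.

Section LieTheory.
Variables (K : fieldType) (g : lieAlgType K).
Implicit Types x y z : g.

Lemma bracketDl x y z : [lie x + y, z] = [lie x, z] + [lie y, z].
Proof. by have := bracket_linearl z 1 x y; rewrite !scale1r. Qed.

Lemma bracketDr x y z : [lie x, y + z] = [lie x, y] + [lie x, z].
Proof. by have := bracket_linearr x 1 y z; rewrite !scale1r. Qed.

Lemma bracketC x y : [lie x, y] = - [lie y, x].
Proof.
apply/eqP; rewrite -addr_eq0; apply/eqP.
by have := bracketxx (x + y); rewrite bracketDl !bracketDr !bracketxx add0r addr0.
Qed.

Lemma bracket0l x : [lie 0, x] = 0.
Proof. by apply: (@addrI _ [lie 0, x]); rewrite -bracketDl !addr0. Qed.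

Lemma bracket0r x : [lie x, 0] = 0.
Proof. by rewrite bracketC bracket0l oppr0. Qed.

Lemma bracketNr x y : [lie x, - y] = - [lie x, y].
Proof. by apply/eqP; rewrite -addr_eq0 -bracketDr addNr bracket0r. Qed.

End LieTheory.

(* Representations of h on k by derivations of the Lie algebra k. *)
Record derRep (K : fieldType) (h k : lieAlgType K) := DerRep {
  derRep_fun :> 'Hom(h, 'End(k));
  derRep_lie : forall x y : h,
    derRep_fun [lie x, y]
      = ((derRep_fun x \o derRep_fun y)%VF - (derRep_fun y \o derRep_fun x)%VF);
  derRep_der : forall (x : h) (u v : k),
    derRep_fun x [lie u, v]
      = [lie derRep_fun x u, v] + [lie u, derRep_fun x v]
}.

(* The semidirect product Lie algebra h (+) k: pairs (x, v), with h embedded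
   as the (x, 0) and the ideal k as the (0, v).  It is an alias of h * k so
   that the bracket can depend on pi. *)
Definition semidirect (K : fieldType) (h k : lieAlgType K)
  (pi : derRep h k) : Type := (h * k)%type.

HB.instance Definition _ (K : fieldType) (h k : lieAlgType K)
  (pi : derRep h k) := Vector.copy (semidirect pi) (h * k)%type.

Section Semidirect.
Variables (K : fieldType) (h k : lieAlgType K) (pi : derRep h k).
Local Notation g := (semidirect pi).

(* The bilinear alternating extension of the three prescribed brackets
   [x, y]_h, [x, v] = pi x v and [u, v]_k. *)
Definition sd_bracket (p q : g) : g :=
  ([lie p.1, q.1], pi p.1 q.2 - pi q.1 p.2 + [lie p.2, q.2]).

Fact sd_bracket_linearl (q : g) : linear (sd_bracket ^~ q).
Proof.
move=> a p p'; congr (_, _) => /=; rewrite bracket_linearl //.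
rewrite !linearP /= add_lfunE scale_lfunE !scalerDr.
by rewrite [X in X + _ = _]addrACA [LHS]addrACA.
Qed.

Fact sd_bracketxx (p : g) : sd_bracket p p = 0.
Proof. by rewrite /sd_bracket !bracketxx subrr addr0. Qed.

Fact sd_bracketC (p q : g) : sd_bracket p q = - sd_bracket q p.
Proof.
rewrite /sd_bracket bracketC; congr (_, _).
by rewrite /= opprD opprB [in LHS]bracketC.
Qed.

Fact sd_bracket_linearr (p : g) : linear (sd_bracket p).
Proof.
move=> a q q'.
by rewrite sd_bracketC sd_bracket_linearl opprD -scalerN -!sd_bracketC.
Qed.

Fact sd_bracket_jacobi (p q r : g) :
  sd_bracket p (sd_bracket q r) + sd_bracket q (sd_bracket r p)
    + sd_bracket r (sd_bracket p q) = 0.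
Proof.
case: p q r => [x u] [y v] [z w]; congr (_, _) => /=.
  exact: bracket_jacobi.
rewrite !derRep_lie !add_lfunE !opp_lfunE !comp_lfunE.
rewrite !(raddfD, raddfN) /= !derRep_der !bracketDr !bracketNr.
rewrite (bracketC (pi x v)) (bracketC (pi y w)) (bracketC (pi z u)).
rewrite !(opprB, opprD, opprK) !addrA.
rewrite [LHS](ACl ((1*23)*(15*2)*(25*3)*(4*17)*(10*5)*(6*20)*(7*12)*(22*8)
  *(24*11)*(13*26)*(19*14)*(16*21)*(9*18*27))) /=.
by rewrite !subrr !add0r bracket_jacobi.
Qed.

HB.instance Definition _ := isLieAlgebra.Build K g
  sd_bracket_linearl sd_bracket_linearr sd_bracketxx sd_bracket_jacobi.

Lemma semidirectE (p q : g) :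
  [lie p, q] = ([lie p.1, q.1], pi p.1 q.2 - pi q.1 p.2 + [lie p.2, q.2]) :> g.
Proof. by []. Qed.

End Semidirect.

Section Structures.
Variables (K : fieldType) (g : lieAlgType K).
Implicit Types J E : 'End(g).

Definition almost_complex J : Prop := (J \o J)%VF = - \1%VF.

Definition nijenhuis_complex J (Y Z : g) : g :=
  [lie J Y, J Z] - [lie Y, Z] - J [lie J Y, Z] - J [lie Y, J Z].

Definition integrable_complex J : Prop :=
  forall Y Z : g, nijenhuis_complex J Y Z = 0.

Definition almost_paracomplex E : Prop :=
  (E \o E)%VF = \1%VF
  /\ \dim (passmx.leigenspace E 1) = \dim (passmx.leigenspace E (-1)).

Definition nijenhuis_paracomplex E (Y Z : g) : g :=
  [lie E Y, E Z] + [lie Y, Z] - E [lie E Y, Z] - E [lie Y, E Z].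

Definition integrable_paracomplex E : Prop :=
  forall Y Z : g, nijenhuis_paracomplex E Y Z = 0.

Definition complex_product J E : Prop :=
  [/\ almost_complex J /\ integrable_complex J,
      almost_paracomplex E /\ integrable_paracomplex E
    & (J \o E)%VF = - (E \o J)%VF].

End Structures.

Definition cocycle1 (K : fieldType) (h k : lieAlgType K) (pi : derRep h k)
  (theta : 'Hom(h, k)) : Prop :=
  forall x y : h, pi x (theta y) - pi y (theta x) - theta [lie x, y] = 0.

Section InducedStructures.
Variables (K : fieldType) (h k : lieAlgType K) (pi : derRep h k).
Variable j : 'Hom(h, k).
Local Notation g := (semidirect pi).

Definition Jfun (p : g) : g := (- (j^-1)%VF p.2, j p.1).
Definition Efun (p : g) : g := ((j^-1)%VF p.2, j p.1).

Fact Jfun_linear : linear Jfun.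
Proof. by move=> a p q; rewrite /Jfun !linearP. Qed.

Fact Efun_linear : linear Efun.
Proof. by move=> a p q; rewrite /Efun !linearP. Qed.

HB.instance Definition _ := GRing.isLinear.Build K g g _ Jfun Jfun_linear.
HB.instance Definition _ := GRing.isLinear.Build K g g _ Efun Efun_linear.

(* (j^-1)%VF is the inverse of j when j is bijective. *)
Definition Jmap : 'End(g) := linfun Jfun.
Definition Emap : 'End(g) := linfun Efun.

Lemma JmapE (x : h) (v : k) : Jmap (x, v) = (- (j^-1)%VF v, j x).
Proof. by rewrite lfunE. Qed.

Lemma EmapE (x : h) (v : k) : Emap (x, v) = ((j^-1)%VF v, j x).
Proof. by rewrite lfunE. Qed.

Hypothesis j_bij : bijective j.

Lemma iso_invK : cancel (j^-1)%VF j.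
Proof.
move: j_bij => [i jK iK] v; rewrite -[v]iK.
by rewrite lker0_lfunK //; apply/lker0P/(can_inj jK).
Qed.

Lemma iso_K : cancel j (j^-1)%VF.
Proof. by apply/lker0_lfunK/lker0P/bij_inj. Qed.

Lemma Jmap_almost_complex : almost_complex Jmap.
Proof.
apply/lfunP=> -[x v]; rewrite comp_lfunE opp_lfunE id_lfunE !JmapE.
by rewrite linearN /= iso_K iso_invK.
Qed.

(* J exchanges the two eigenspaces of E. *)
Lemma Emap_almost_paracomplex : almost_paracomplex Emap.
Proof.
have EE : (Emap \o Emap)%VF = \1%VF.
  by apply/lfunP=> -[x v]; rewrite comp_lfunE id_lfunE !EmapE iso_K iso_invK.
split; first exact: EE.
have JE p : Jmap (Emap p) = - Emap (Jmap p).
  case: p => x v; rewrite !(JmapE, EmapE) iso_K iso_invK [j (- _)]linearN /= iso_invK.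
  by congr (_, _); rewrite /= opprK.
have Jinj : lker Jmap == 0%VS.
  apply/lker0P=> p q eqJ; apply: oppr_inj.
  have /lfunP JJ := Jmap_almost_complex.
  by have := JJ p; have := JJ q; rewrite !comp_lfunE !opp_lfunE !id_lfunE eqJ
    => -> ->.
have le a : (\dim (passmx.leigenspace Emap a)
             <= \dim (passmx.leigenspace Emap (- a)))%N.
  rewrite -(limg_dim_eq (f := Jmap)); last by rewrite (eqP Jinj) capv0.
  apply/dimvS/subvP=> _ /memv_imgP[p + ->]; rewrite !memv_ker.
  rewrite !(add_lfunE, opp_lfunE, scale_lfunE, id_lfunE) scaleNr opprK.
  rewrite subr_eq0 => /eqP Ep; rewrite -linearZ /= -Ep JE subrr //.
have leN := le (-1); rewrite opprK in leN.
exact: anti_leq (introT andP (conj (le 1) leN)).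
Qed.

End InducedStructures.

(* Main.v *)
Require Import Defs.
From mathcomp Require Import all_boot all_algebra reals.

Set Implicit Arguments.
Unset Strict Implicit.
Unset Printing Implicit Defensive.

Import GRing.Theory.
Local Open Scope ring_scope.

(** For a scalar e put F(x, v) = (e j^-1 v, j x); J and E are the cases e = -1
    and e = 1, and N_F(Y, Z) = [FY, FZ] + e [Y, Z] - F[FY, Z] - F[Y, FZ] is the
    corresponding torsion.  On h it is
      N_F(x, y) = (e ([x, y] - j^-1 (pi(x) j y - pi(y) j x)), [j x, j y]),
    so for e <> 0 its vanishing on h already says that k is abelian and j is a
    cocycle.  Conversely, writing elements of k as j x', the cocycle identity
    pi(x) j y - pi(y) j x = j [x, y] cancels all terms of N_F. *)

Lemma bracketZl (K : fieldType) (g : lieAlgType K) (a : K) (x y : g) :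
  [lie a *: x, y] = a *: [lie x, y].
Proof. by have := bracket_linearl y a x 0; rewrite bracket0l !addr0. Qed.

Lemma bracketZr (K : fieldType) (g : lieAlgType K) (a : K) (x y : g) :
  [lie x, a *: y] = a *: [lie x, y].
Proof. by rewrite bracketC bracketZl -scalerN -bracketC. Qed.

Section TwistedSwap.
Variables (K : fieldType) (h k : lieAlgType K) (pi : derRep h k).
Variables (j : 'Hom(h, k)) (e : K) (F : semidirect pi -> semidirect pi).
Hypothesis j_bij : bijective j.
Hypothesis FE : forall x v, F (x, v) = (e *: (j^-1)%VF v, j x).

(** For bijective [j], F^2 = e Id, so the term e [Y, Z] is F^2 [Y, Z] and this is the usual
    Nijenhuis torsion of F. *)
Let torsion (Y Z : semidirect pi) : semidirect pi :=
  [lie F Y, F Z] + e *: [lie Y, Z] - F [lie F Y, Z] - F [lie Y, F Z].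

Lemma torsion_h (x y : h) :
  torsion (x, 0) (y, 0)
    = (e *: ([lie x, y] - (j^-1)%VF (pi x (j y) - pi y (j x))), [lie j x, j y]).
Proof.
rewrite /torsion !FE !semidirectE /=.
rewrite !(linear0, scaler0, bracket0l, bracket0r, add0r, addr0, subr0, sub0r).
rewrite !lfunE /= ?(linear0, scaler0, subr0, addr0).
congr (_, _) => /=; last by rewrite scaler0 !subr0 addr0 add0r.
by rewrite add0r -addrA -opprD -scalerDr -linearD -scalerBr [- _ + _]addrC.
Qed.

Lemma torsion_eq0_iff : e != 0 ->
  (forall Y Z, torsion Y Z = 0) <-> lie_abelian k /\ cocycle1 pi j.
Proof.
move=> e0; split=> [N0 | [kab jcoc] [x u] [y v]].
  split=> [u v | x y].
    (* As [j] is onto, the brackets [j x, j y] exhaust those of k. *)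
    have := N0 ((j^-1)%VF u, 0) ((j^-1)%VF v, 0).
    by rewrite torsion_h => -[_]; rewrite !iso_invK.
  have := N0 (x, 0) (y, 0).
  rewrite torsion_h => -[/eqP]; rewrite scaler_eq0 (negPf e0) subr_eq0 /=.
  by move=> /eqP-> _; rewrite iso_invK // subrr.
have jcocE z t : pi z (j t) - pi t (j z) = j [lie z, t].
  exact/subr0_eq/jcoc.
rewrite -[u](iso_invK j_bij) -[v](iso_invK j_bij).
move: (_ u) (_ v) => x' y'.
rewrite /torsion !FE !semidirectE /= !iso_K // !kab !addr0.
rewrite !(bracketZl, bracketZr) !linearZ /= !scale_lfunE.
congr (_, _) => /=.
  (* In h the pi-terms pair up by (x', y'), with factor e, and (x, y): [jcocE] turns them into j (e
     [x', y'] + [x, y]). *)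
  rewrite -addrA -opprD -!scalerDr -[(j^-1)%VF _ + _]linearD /= addrACA.
  rewrite [- _ + - _]addrC -addrACA -[e *: pi x' _ - _]scalerBr !jcocE.
  by rewrite [(j^-1)%VF _]linearP /= !iso_K // subrr.
(* In k the mixed pairs (x', y) and (x, y') occur instead, and match the terms j [x', y] and j
   [x, y']. *)
rewrite -scalerBr -[_ - _ - _]addrA -opprD -!scalerDr addrACA.
by rewrite [- _ + - _]addrC -addrACA !jcocE subrr.
Qed.

End TwistedSwap.

Theorem theorem3p2 (R : realType) (h k : lieAlgType R) (pi : derRep h k)
    (j : 'Hom(h, k)) (j_iso : bijective j) :
  [<-> integrable_complex (Jmap pi j);
       integrable_paracomplex (Emap pi j);
       lie_abelian k /\ cocycle1 pi j]
  /\ (lie_abelian k -> cocycle1 pi j ->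
      complex_product (Jmap pi j) (Emap pi j)).
Proof.
have JP : integrable_complex (Jmap pi j) <-> lie_abelian k /\ cocycle1 pi j.
  have JE x v : Jmap pi j (x, v) = (-1 *: (j^-1)%VF v, j x).
    by rewrite JmapE scaleN1r.
  rewrite -(torsion_eq0_iff j_iso JE) ?oppr_eq0 ?oner_eq0 //.
  by split=> N0 Y Z; have := N0 Y Z; rewrite /nijenhuis_complex scaleN1r.
have EP : integrable_paracomplex (Emap pi j) <-> lie_abelian k /\ cocycle1 pi j.
  have EE x v : Emap pi j (x, v) = (1 *: (j^-1)%VF v, j x).
    by rewrite EmapE scale1r.
  rewrite -(torsion_eq0_iff j_iso EE) ?oner_eq0 //.
  by split=> N0 Y Z; have := N0 Y Z; rewrite /nijenhuis_paracomplex scale1r.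
split; first by tfae=> [/JP/EP | /EP | /JP].
move=> kab jcoc; split.
- by split; [exact: Jmap_almost_complex | exact/JP].
- by split; [exact: Emap_almost_paracomplex | exact/EP].
(* Both sides send (x, v) to (- x, v). *)
apply/lfunP=> -[x v]; rewrite opp_lfunE !comp_lfunE !(JmapE, EmapE).
rewrite iso_K // iso_invK // [j (- _)]linearN /= iso_invK //.
by congr (_, _); rewrite /= opprK.
Qed.
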